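(* Let the complex-valued harmonic function $f(z) = h(z) - \overline{z}$, with $h$ analytic, have an isolated singular zero at $z_0 \in \mathbb{C}$, and let $h'(z_0) = e^{i\theta}$ with $\theta \in \mathbb{R}$. Let $n \geq 2$ be the smallest index with $h^{(n)}(z_0) = c e^{i\varphi} \neq 0$, where $c > 0$ and $\varphi \in \mathbb{R}$, and set $$\eta := \cos\left(\varphi - \tfrac{n+1}{2}\theta\right).$$ Then $$\mathrm{ind}(f; z_0) = \begin{cases} 0 & \text{if } \eta \neq 0 \text{ and } n \text{ is even}, \\ +1 & \text{if } \eta > 0 \text{ and } n \text{ is odd}, \\ -1 & \text{if } \eta < 0 \text{ and } n \text{ is odd}. \end{cases}$$
   Context: For $f(z) = h(z) - \overline{z}$ with $h$ analytic, a zero $z_0$ of $f$ is called singular if $|h'(z_0)| = 1$. Winding: for a curve $\Gamma$ parametrized by a continuous $\gamma : [a,b] \to \mathbb{C}$ and a continuous function $f : \Gamma \to \mathbb{C}$ without zeros on $\Gamma$, the winding of $f$ on $\Gamma$ is $V(f;\Gamma) = \frac{1}{2\pi}[\arg(f(\gamma(b))) - \arg(f(\gamma(a)))]$, where $\arg(f\circ\gamma)$ is a continuous branch of the argument along $\gamma$. Poincaré index: if $f$ is continuous and nonzero in a punctured disk $\{z : 0 < |z - z_0| < R\}$, then $\mathrm{ind}(f; z_0) := V(f; \Gamma_r)\in\mathbb{Z}$, where $0 < r < R$ and $\Gamma_r$ is the positively oriented circle with center $z_0$ and radius $r$ (the value does not depend on $r$). *)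

(* Defs.v *)
From Stdlib Require Import Reals ZArith Arith.
From Coquelicot Require Import Coquelicot.

Open Scope R_scope.

Definition analytic_at (h : C -> C) (z0 : C) : Prop :=
  exists (a : nat -> C) (r : R), 0 < r /\
    forall z : C, Cmod (z - z0)%C < r ->
      is_pseries (K := C_AbsRing) (V := C_NormedModule) a (z - z0)%C (h z).

Definition analytic_on (D : C -> Prop) (h : C -> C) : Prop :=
  forall z : C, D z -> analytic_at h z.

(* Coquelicot's total [C_derive] is the complex derivative wherever the function
   is complex differentiable ([is_C_derive_unique]). *)
Definition C_derive_n (n : nat) (h : C -> C) : C -> C := Nat.iter n C_derive h.

Definition cis (t : R) : C := (cos t, sin t).

Definition harmonic_of (h : C -> C) (z : C) : C := (h z - Cconj z)%C.

Definition punctured_disk (z0 : C) (R0 : R) (z : C) : Prop :=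
  0 < Cmod (z - z0)%C < R0.

Definition isolated_zero (D : C -> Prop) (f : C -> C) (z0 : C) : Prop :=
  D z0 /\ f z0 = 0%C /\
  exists R0 : R, 0 < R0 /\
    forall z : C, D z -> punctured_disk z0 R0 z -> f z <> 0%C.

Definition singular_zero (h : C -> C) (z0 : C) : Prop :=
  harmonic_of h z0 = 0%C /\ Cmod (C_derive h z0) = 1.

Definition segment (a b : R) (t : R) : Prop := a <= t <= b.

Definition trace (g : R -> C) (a b : R) (z : C) : Prop :=
  exists t : R, segment a b t /\ z = g t.

(* [winding f g a b v]: V(f; Gamma) is defined and equal to [v], where Gamma is
   parametrized by [g] on [a, b].  [phi] is the continuous branch of the argument
   of [f] along [g]; two branches differ by a constant, so [v] is unique. *)
Definition winding (f : C -> C) (g : R -> C) (a b v : R) : Prop :=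
  a <= b /\
  continuous_on (segment a b) g /\
  continuous_on (trace g a b) f /\
  (forall z : C, trace g a b z -> f z <> 0%C) /\
  exists phi : R -> R,
    continuous_on (segment a b) phi /\
    (forall t : R, segment a b t ->
       f (g t) = (RtoC (Cmod (f (g t))) * cis (phi t))%C) /\
    v = / (2 * PI) * (phi b - phi a).

Definition circle (z0 : C) (r : R) (t : R) : C := (z0 + RtoC r * cis t)%C.

Definition index_radius (f : C -> C) (z0 : C) (R0 : R) : Prop :=
  0 < R0 /\
  continuous_on (punctured_disk z0 R0) f /\
  (forall z : C, punctured_disk z0 R0 z -> f z <> 0%C).

(* [poincare_index f z0 k]: ind(f; z0) is defined and equal to [k]; the
   independence of the radii is part of the assertion. *)
Definition poincare_index (f : C -> C) (z0 : C) (k : Z) : Prop :=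
  (exists R0 : R, index_radius f z0 R0) /\
  (forall R0 r : R, index_radius f z0 R0 -> 0 < r < R0 ->
     winding f (circle z0 r) 0 (2 * PI) (IZR k)).

(* Main.v *)
Require Import Defs.
From Stdlib Require Import Reals ZArith Arith Lra Lia.
From Coquelicot Require Import Coquelicot.
Open Scope R_scope.

(** Let [b = c / n!], [alpha = phi - (n + 1) theta / 2] and [w = r cis (t - theta / 2)].
    The Taylor expansion of [h] gives
    [cis (- theta / 2) f (z0 + w) = 2 i r sin t + b r^n cis (alpha + n t) + O (r^(n+1))].
    For small [r] the imaginary part has the sign of [sin t], except near the zeros of
    [sin t]; there [cos t] is close to [1] or [-1], and the real part has the sign of
    [eta (cos t)^n].  Hence the curve is never opposite to a model curve: [cis t]
    ([n] odd, [eta > 0]), [cis (PI - t)] ([n] odd, [eta < 0]) or a constant ([n] even).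
    Two closed curves which are never opposite have the same winding, since the
    principal argument of their quotient is continuous.  The same principle, with
    uniform continuity of [f / |f|] on closed annuli, moves the result from small
    circles to every admissible radius. *)

(** * Complex power series *)

Ltac ring_C :=
  unfold scal, plus, opp; simpl; unfold mult; simpl;
  match goal with |- @eq _ ?x ?y => change (@eq C x y) end; ring.

Lemma Re_sum_n (a : nat -> C) (N : nat) :
  fst (sum_n (G := C_NormedModule) a N) = sum_n (fun k => fst (a k)) N.
Proof.
  induction N as [|N IH]; [now rewrite !sum_O|].
  now rewrite !sum_Sn, <- IH.
Qed.

Lemma Im_sum_n (a : nat -> C) (N : nat) :
  snd (sum_n (G := C_NormedModule) a N) = sum_n (fun k => snd (a k)) N.
Proof.
  induction N as [|N IH]; [now rewrite !sum_O|].
  now rewrite !sum_Sn, <- IH.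
Qed.

Lemma filterlim_C_pair (T : Type) (F : (T -> Prop) -> Prop) {FF : Filter F}
  (f : T -> C) (l : C) :
  filterlim (fun x => fst (f x)) F (locally (fst l)) ->
  filterlim (fun x => snd (f x)) F (locally (snd l)) ->
  filterlim f F (locally (T := C_UniformSpace) l).
Proof.
  intros H1 H2.
  apply filterlim_locally. intros eps.
  eapply filter_imp; [|apply filter_and;
    [exact (proj1 (filterlim_locally _ _) H1 eps)|exact (proj1 (filterlim_locally _ _) H2 eps)]].
  intros x [Hx Hy]. split; assumption.
Qed.

Lemma is_series_C_pair (a : nat -> C) (l : C) :
  is_series (fun k => fst (a k)) (fst l) ->
  is_series (fun k => snd (a k)) (snd l) ->
  is_series (V := C_NormedModule) a l.
Proof.
  intros H1 H2. apply (filterlim_C_pair nat eventually).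
  - eapply filterlim_ext; [intro N; symmetry; apply Re_sum_n|exact H1].
  - eapply filterlim_ext; [intro N; symmetry; apply Im_sum_n|exact H2].
Qed.

Lemma Rabs_fst_le_Cmod (z : C) : Rabs (fst z) <= Cmod z.
Proof. eapply Rle_trans; [apply Rmax_l|apply Rmax_Cmod]. Qed.

Lemma Rabs_snd_le_Cmod (z : C) : Rabs (snd z) <= Cmod z.
Proof. eapply Rle_trans; [apply Rmax_r|apply Rmax_Cmod]. Qed.

(** The bound [b] dominates the real and imaginary parts as well, so the real comparison test
    applies to each of them. *)
Lemma ex_series_C_le (a : nat -> C) (b : nat -> R) :
  (forall k, Cmod (a k) <= b k) -> ex_series b ->
  exists l : C, is_series (V := C_NormedModule) a l.
Proof.
  intros Hab Hb.
  assert (H1 : ex_series (fun k => fst (a k))).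
  { apply (ex_series_le (K := R_AbsRing) (V := R_CompleteNormedModule)) with b; auto.
    intro k. eapply Rle_trans; [apply Rabs_fst_le_Cmod|apply Hab]. }
  assert (H2 : ex_series (fun k => snd (a k))).
  { apply (ex_series_le (K := R_AbsRing) (V := R_CompleteNormedModule)) with b; auto.
    intro k. eapply Rle_trans; [apply Rabs_snd_le_Cmod|apply Hab]. }
  destruct H1 as [l1 H1], H2 as [l2 H2].
  exists (l1, l2). now apply is_series_C_pair.
Qed.

Lemma Cmod_series_le (a : nat -> C) (l : C) (b : nat -> R) (B : R) :
  is_series (V := C_NormedModule) a l -> (forall k, Cmod (a k) <= b k) ->
  is_series b B -> Cmod l <= B.
Proof.
  intros Ha Hab Hb.
  assert (Hl : is_lim_seq (fun N => Cmod (sum_n (G := C_NormedModule) a N)) (Cmod l)).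
  { apply (filterlim_comp _ _ _ _ (@norm _ C_NormedModule) eventually (locally (T := C_NormedModule) l)).
    exact Ha. exact (filterlim_norm (K := C_AbsRing) (V := C_NormedModule) l). }
  apply (is_lim_seq_le (fun N => Cmod (sum_n (G := C_NormedModule) a N)) (sum_n b) (Cmod l) B);
    [|exact Hl|exact Hb].
  intro N. induction N as [|N IH].
  - rewrite !sum_O. apply Hab.
  - rewrite !sum_Sn. eapply Rle_trans; [apply Cmod_triangle|].
    apply Rplus_le_compat; [exact IH|apply Hab].
Qed.

(** Partial sums of a convergent series are bounded, and each term after the first is a difference
    of two consecutive ones. *)
Lemma is_series_C_terms_bounded (a : nat -> C) (l : C) :
  is_series (V := C_NormedModule) a l -> exists M, forall k, Cmod (a k) <= M.
Proof.
  intro Ha.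
  destruct (filterlim_bounded (K := C_AbsRing) (V := C_NormedModule)
              (sum_n (G := C_NormedModule) a)) as [M HM]; [now exists l|].
  change (forall k, Cmod (sum_n (G := C_NormedModule) a k) <= M) in HM.
  exists (M + M). intros [|k].
  - generalize (HM 0%nat) (Cmod_ge_0 (a 0%nat)). rewrite sum_O. lra.
  - replace (a (S k)) with (sum_n (G := C_NormedModule) a (S k) - sum_n (G := C_NormedModule) a k)%C.
    + unfold Cminus. eapply Rle_trans; [apply Cmod_triangle|]. rewrite Cmod_opp.
      apply Rplus_le_compat; apply HM.
    + rewrite sum_Sn. ring_C.
Qed.

(** The expansion in [analytic_at], with [pow_n] and [scal] replaced by the power and product of
    [C], so that [ring] and the rules for [Cmod] apply to its terms. *)
Definition power_series_on (a : nat -> C) (z0 : C) (r : R) (h : C -> C) : Prop :=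
  forall z : C, Cmod (z - z0)%C < r ->
    is_series (V := C_NormedModule) (fun k => ((z - z0) ^ k * a k)%C) (h z).

Lemma pow_n_Cpow (z : C) (k : nat) : pow_n (K := C_Ring) z k = (z ^ k)%C.
Proof. induction k as [|k IH]; simpl; [reflexivity|now rewrite IH]. Qed.

Lemma analytic_at_power_series (h : C -> C) (z0 : C) :
  analytic_at h z0 -> exists a r, 0 < r /\ power_series_on a z0 r h.
Proof.
  intros (a & r & Hr & H). exists a, r. split; [exact Hr|].
  intros z Hz. eapply is_series_ext; [|exact (H z Hz)].
  intro k. now rewrite <- pow_n_Cpow.
Qed.

(** The series converges at the point [z0 + rho], so its terms there are bounded. *)
Lemma power_series_coeff_bound (a : nat -> C) (z0 : C) (r : R) (h : C -> C) (rho : R) :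
  power_series_on a z0 r h -> 0 < rho < r ->
  exists M, forall k, Cmod (a k) * rho ^ k <= M.
Proof.
  intros H Hrho.
  assert (E : (z0 + RtoC rho - z0)%C = RtoC rho) by ring.
  assert (Hz : Cmod (z0 + RtoC rho - z0)%C < r).
  { rewrite E, Cmod_R, Rabs_pos_eq; lra. }
  destruct (is_series_C_terms_bounded _ _ (H _ Hz)) as [M HM].
  exists M. intro k. generalize (HM k).
  rewrite E, Cmod_mult, Cmod_pow, Cmod_R, Rabs_pos_eq by lra. lra.
Qed.

(** Ratio test: consecutive terms have ratio [(1 + 1 / (k + 1)) ^ 2 * q], which tends to [q]. The
    quadratic factor will absorb the [INR k ^ 2] of [Cpow_taylor_error]. *)
Lemma ex_series_sqr_geom (q : R) : 0 < q < 1 ->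
  ex_series (fun k => (INR k + 1) ^ 2 * q ^ k).
Proof.
  intros Hq.
  assert (Hk : forall k, 0 < INR k + 1) by (intro k; generalize (pos_INR k); lra).
  assert (Hp : forall k, 0 < (INR k + 1) ^ 2 * q ^ k).
  { intro k. apply Rmult_lt_0_compat; apply pow_lt; [apply Hk|lra]. }
  apply (ex_series_ext (fun k => Rabs ((INR k + 1) ^ 2 * q ^ k))).
  { intro k. apply Rabs_pos_eq, Rlt_le, Hp. }
  apply ex_series_DAlembert with q; [lra|intro k; apply Rgt_not_eq, Hp|].
  apply is_lim_seq_ext with (fun k => (1 + / INR (S k)) ^ 2 * q).
  { intro k. rewrite Rabs_pos_eq.
    - rewrite S_INR. simpl pow. field. split; [apply pow_nonzero; lra|apply Rgt_not_eq, Hk].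
    - apply Rlt_le, Rdiv_lt_0_compat; apply Hp. }
  assert (L : is_lim_seq (fun k => / INR (S k)) 0).
  { apply (is_lim_seq_incr_1 (fun k => / INR k)).
    apply (is_lim_seq_inv INR p_infty). apply is_lim_seq_INR. discriminate. }
  assert (L1 : is_lim_seq (fun k => 1 + / INR (S k)) 1).
  { replace (Finite 1) with (Finite (1 + 0)) by (f_equal; ring).
    apply is_lim_seq_plus'; [apply is_lim_seq_const|exact L]. }
  replace (Finite q) with (Finite (1 * (1 * 1) * q)) by (f_equal; ring).
  apply is_lim_seq_mult'; [|apply is_lim_seq_const].
  simpl pow. repeat apply is_lim_seq_mult'; try exact L1. apply is_lim_seq_const.
Qed.

(** The factor [s ^ 2] stands on the left to avoid the truncated exponent [k - 2]. Passing from [k]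
    to [S k] multiplies the error by [w] and adds [k v^(k-1) (w - v)^2], and [k^2 + k <= (k + 1)^2]
    closes the induction. *)
Lemma Cpow_taylor_error (v w : C) (s : R) (k : nat) :
  0 <= s -> Cmod v <= s -> Cmod w <= s ->
  s ^ 2 * Cmod (w ^ k - v ^ k - RtoC (INR k) * v ^ (k - 1) * (w - v))%C
    <= INR k ^ 2 * s ^ k * Cmod (w - v)%C ^ 2.
Proof.
  intros Hs Hv Hw.
  induction k as [|k IH].
  { replace (w ^ 0 - v ^ 0 - RtoC (INR 0) * v ^ (0 - 1) * (w - v))%C with (RtoC 0) by (simpl; ring).
    rewrite Cmod_0. simpl. lra. }
  set (E := (w ^ k - v ^ k - RtoC (INR k) * v ^ (k - 1) * (w - v))%C) in *.
  replace (w ^ (S k) - v ^ (S k) - RtoC (INR (S k)) * v ^ (S k - 1) * (w - v))%C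
    with (w * E + RtoC (INR k) * v ^ (k - 1) * (w - v) ^ 2)%C.
  2:{ unfold E. rewrite S_INR, RtoC_plus. replace (S k - 1)%nat with k by lia.
      destruct k as [|k]; [simpl; ring|].
      replace (S k - 1)%nat with k by lia. rewrite !Cpow_S. simpl. ring. }
  set (d := Cmod (w - v)%C) in *.
  assert (Hd : 0 <= d) by apply Cmod_ge_0.
  assert (Hk := pos_INR k).
  apply Rle_trans with (s ^ 2 * (s * Cmod E + INR k * Cmod v ^ (k - 1) * d ^ 2)).
  { apply Rmult_le_compat_l; [nra|].
    eapply Rle_trans; [apply Cmod_triangle|].
    rewrite !Cmod_mult, !Cmod_pow, Cmod_R, (Rabs_pos_eq _ Hk). fold d.
    apply Rplus_le_compat_r, Rmult_le_compat_r; [apply Cmod_ge_0|exact Hw]. }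
  assert (H2 : s ^ 2 * (INR k * Cmod v ^ (k - 1)) <= INR k * s ^ S k).
  { destruct k as [|k]; [simpl; lra|].
    replace (S k - 1)%nat with k by lia.
    replace (s ^ S (S k)) with (s ^ 2 * s ^ k) by (simpl; ring).
    assert (Cmod v ^ k <= s ^ k) by (apply pow_incr; split; [apply Cmod_ge_0|exact Hv]).
    assert (0 <= s ^ 2) by nra.
    assert (0 <= s ^ 2 * INR (S k)) by nra. nra. }
  assert (H3 : s * (s ^ 2 * Cmod E) <= s * (INR k ^ 2 * s ^ k * d ^ 2))
    by (apply Rmult_le_compat_l; assumption).
  assert (H4 : s ^ 2 * (INR k * Cmod v ^ (k - 1)) * d ^ 2 <= INR k * s ^ S k * d ^ 2)
    by (apply Rmult_le_compat_r; [nra|exact H2]).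
  assert (H5 : 0 <= s ^ S k * d ^ 2 * (INR k + 1)).
  { apply Rmult_le_pos; [|lra]. apply Rmult_le_pos; [apply pow_le; lra|nra]. }
  rewrite S_INR. simpl pow in *. nra.
Qed.

Lemma is_derive_C_quadratic (h : C -> C) (v l : C) (K rho : R) :
  0 < rho ->
  (forall w, Cmod (w - v)%C < rho ->
     Cmod (h w - h v - (w - v) * l)%C <= K * Cmod (w - v)%C ^ 2) ->
  is_derive (K := C_AbsRing) (V := C_NormedModule) h v l.
Proof.
  intros Hrho H. split; [apply is_linear_scal_l|].
  intros x Hx eps.
  (* [is_derive] asks for the estimate at every limit [x] of the neighbourhood filter of [v]; the
     only such limit is [v]. *)
  assert (Ex : v = x).
  { apply (is_filter_lim_locally_unique (K := C_AbsRing) (V := AbsRing_NormedModule C_AbsRing)). exact Hx. }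
  subst x.
  assert (HK : 0 < Rabs K + 1) by (generalize (Rabs_pos K); lra).
  assert (Hd : 0 < Rmin rho (eps / (Rabs K + 1))).
  { apply Rmin_pos; [exact Hrho|apply Rdiv_lt_0_compat; [apply cond_pos|exact HK]]. }
  exists (mkposreal _ Hd). intros w Hw.
  change (Cmod (w - v)%C < Rmin rho (eps / (Rabs K + 1))) in Hw.
  change (Cmod (h w - h v - (w - v) * l)%C <= eps * Cmod (w - v)%C).
  assert (Hw1 := Rlt_le_trans _ _ _ Hw (Rmin_l _ _)).
  assert (Hw2 := Rlt_le_trans _ _ _ Hw (Rmin_r _ _)).
  eapply Rle_trans; [apply H, Hw1|].
  assert (H0 := Cmod_ge_0 (w - v)%C).
  assert (Hm : Cmod (w - v)%C * (Rabs K + 1) < eps).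
  { apply (Rmult_lt_compat_r _ _ _ HK) in Hw2. unfold Rdiv in Hw2.
    rewrite Rmult_assoc, Rinv_l, Rmult_1_r in Hw2; lra. }
  generalize (Rle_abs K). nra.
Qed.

(** Termwise differentiation. The coefficient bound at [rho] makes the series of
    [(k + 1)^2 |a k| s^k] converge for [s < rho]; it dominates the derived series and also sums the
    errors of [Cpow_taylor_error] into one quadratic bound. *)
Lemma power_series_derive (a : nat -> C) (z0 : C) (r : R) (h : C -> C) (z : C) :
  power_series_on a z0 r h -> Cmod (z - z0)%C < r ->
  exists l : C,
    is_series (V := C_NormedModule)
      (fun k => ((z - z0) ^ k * (RtoC (INR (S k)) * a (S k)))%C) l /\
    is_derive (K := C_AbsRing) (V := C_NormedModule) h z l.
Proof.
  intros H Hz.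
  set (v := (z - z0)%C) in *.
  assert (Hv := Cmod_ge_0 v).
  (* [s] and [rho] cut the interval from [Cmod v] to [r] into thirds. *)
  set (s := (2 * Cmod v + r) / 3). set (rho := (Cmod v + 2 * r) / 3).
  assert (Hs : Cmod v < s) by (unfold s; lra).
  assert (Hsr : s < rho) by (unfold s, rho; lra).
  assert (Hr : rho < r) by (unfold rho; lra).
  assert (Hs0 : 0 < s) by lra.
  destruct (power_series_coeff_bound a z0 r h rho H) as [M HM]; [lra|].
  set (b := fun k => (INR k + 1) ^ 2 * (Cmod (a k) * s ^ k)).
  assert (Hb0 : forall k, 0 <= Cmod (a k) * s ^ k).
  { intro k. apply Rmult_le_pos; [apply Cmod_ge_0|apply pow_le; lra]. }
  assert (Hb : ex_series b).
  { apply (ex_series_le (K := R_AbsRing) (V := R_CompleteNormedModule)) with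
      (fun k => scal M ((INR k + 1) ^ 2 * (s / rho) ^ k)).
    - intro k. change (Rabs (b k) <= M * ((INR k + 1) ^ 2 * (s / rho) ^ k)).
      unfold b. rewrite Rabs_pos_eq by (apply Rmult_le_pos; [apply pow2_ge_0|apply Hb0]).
      replace (M * ((INR k + 1) ^ 2 * (s / rho) ^ k)) with ((INR k + 1) ^ 2 * (M * (s / rho) ^ k)) by ring.
      apply Rmult_le_compat_l; [apply pow2_ge_0|].
      replace (Cmod (a k) * s ^ k) with (Cmod (a k) * rho ^ k * (s / rho) ^ k).
      2:{ unfold Rdiv. rewrite Rpow_mult_distr, pow_inv. field. apply pow_nonzero. lra. }
      apply Rmult_le_compat_r; [|apply HM]. apply pow_le, Rlt_le, Rdiv_lt_0_compat; lra.
    - apply (ex_series_scal (K := R_AbsRing) (V := R_NormedModule)), ex_series_sqr_geom.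
      split; [apply Rdiv_lt_0_compat; lra|]. apply Rmult_lt_reg_r with rho; [lra|].
      unfold Rdiv. rewrite Rmult_assoc, Rinv_l; lra. }
  destruct Hb as [B HB].
  destruct (ex_series_C_le (fun k => (v ^ k * (RtoC (INR (S k)) * a (S k)))%C)
              (fun k => / s * b (S k))) as [l Hl].
  { intro k. rewrite !Cmod_mult, Cmod_pow, Cmod_R, Rabs_pos_eq by apply pos_INR.
    unfold b. replace (/ s * ((INR (S k) + 1) ^ 2 * (Cmod (a (S k)) * s ^ S k)))
      with ((INR (S k) + 1) ^ 2 * (Cmod (a (S k)) * s ^ k)) by (simpl; field; lra).
    assert (Cmod v ^ k <= s ^ k) by (apply pow_incr; lra).
    assert (0 <= Cmod v ^ k) by (apply pow_le; lra).
    assert (Ha := Cmod_ge_0 (a (S k))). assert (Hk := pos_INR (S k)).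
    apply Rle_trans with (INR (S k) * (Cmod (a (S k)) * s ^ k)).
    - replace (Cmod v ^ k * (INR (S k) * Cmod (a (S k)))) with (INR (S k) * (Cmod (a (S k)) * Cmod v ^ k)) by ring.
      apply Rmult_le_compat_l; [exact Hk|]. now apply Rmult_le_compat_l.
    - apply Rmult_le_compat_r; [|nra].
      apply Rmult_le_pos; [exact Ha|lra]. }
  { apply (ex_series_scal (K := R_AbsRing) (V := R_NormedModule) (/ s) (fun k => b (S k))).
    apply (proj1 (ex_series_incr_1 b)). now exists B. }
  exists l. split; [exact Hl|].
  (* The derived series is re-indexed to match the linear terms of [Cpow_taylor_error]. At [k = 0]
     the truncated [k - 1] is harmless, since the factor [INR 0] vanishes. *)
  assert (Hl' : is_series (V := C_NormedModule) (fun k => (RtoC (INR k) * v ^ (k - 1) * a k)%C) l).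
  { apply is_series_decr_1.
    match goal with |- is_series _ ?x => replace x with l end.
    2:{ ring_C. }
    eapply is_series_ext; [|exact Hl]. intro k.
    replace (S k - 1)%nat with k by lia. ring_C. }
  (* The radius [s - Cmod v] keeps [u] in the disk of radius [s], where [Cpow_taylor_error] holds;
     [B] is the sum of the series [b]. *)
  apply is_derive_C_quadratic with (/ s ^ 2 * B) (s - Cmod v); [lra|].
  intros w Hw.
  set (u := (w - z0)%C).
  assert (Euv : (w - z)%C = (u - v)%C) by (unfold u, v; ring).
  rewrite Euv in *.
  assert (Hu : Cmod u <= s).
  { replace u with (v + (u - v))%C by ring.
    eapply Rle_trans; [apply Cmod_triangle|]. lra. }
  assert (Hser : is_series (V := C_NormedModule)
    (fun k => ((u ^ k - v ^ k - RtoC (INR k) * v ^ (k - 1) * (u - v)) * a k)%C)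
    (h w - h z - (u - v) * l)%C).
  { assert (H1 := H w ltac:(fold u; lra)). assert (H2 := H z Hz). fold u in H1. fold v in H2.
    assert (H3 := is_series_minus _ _ _ _ (is_series_minus _ _ _ _ H1 H2)
                    (is_series_scal_l (u - v)%C _ _ Hl')).
    eapply is_series_ext; [|exact H3].
    intro k. ring_C. }
  replace (/ s ^ 2 * B * Cmod (u - v)%C ^ 2) with ((/ s ^ 2 * Cmod (u - v)%C ^ 2) * B) by ring.
  eapply Cmod_series_le; [exact Hser| |exact (is_series_scal_l (V := R_NormedModule) (/ s ^ 2 * Cmod (u - v)%C ^ 2) _ _ HB)].
  intro k.
  change (Cmod ((u ^ k - v ^ k - RtoC (INR k) * v ^ (k - 1) * (u - v)) * a k)%C
    <= (/ s ^ 2 * Cmod (u - v)%C ^ 2) * b k).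
  rewrite Cmod_mult.
  assert (HT := Cpow_taylor_error v u s k (Rlt_le _ _ Hs0) (Rlt_le _ _ Hs) Hu).
  set (e := Cmod (u ^ k - v ^ k - RtoC (INR k) * v ^ (k - 1) * (u - v))%C) in *.
  assert (Hs2 : 0 < s ^ 2) by (apply pow_lt; lra).
  apply Rmult_le_reg_l with (s ^ 2); [exact Hs2|].
  replace (s ^ 2 * (/ s ^ 2 * Cmod (u - v)%C ^ 2 * b k)) with (Cmod (u - v)%C ^ 2 * b k) by (field; lra).
  rewrite <- Rmult_assoc.
  eapply Rle_trans; [apply Rmult_le_compat_r; [apply Cmod_ge_0|exact HT]|].
  unfold b.
  replace (INR k ^ 2 * s ^ k * Cmod (u - v)%C ^ 2 * Cmod (a k))
    with (Cmod (u - v)%C ^ 2 * (INR k ^ 2 * (Cmod (a k) * s ^ k))) by ring.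
  apply Rmult_le_compat_l; [apply pow2_ge_0|].
  apply Rmult_le_compat_r; [apply Hb0|]. generalize (pos_INR k); nra.
Qed.

Lemma power_series_C_derive (a : nat -> C) (z0 : C) (r : R) (h : C -> C) :
  power_series_on a z0 r h ->
  power_series_on (fun k => (RtoC (INR (S k)) * a (S k))%C) z0 r (C_derive h).
Proof.
  intros H z Hz.
  destruct (power_series_derive a z0 r h z H Hz) as (l & Hl & Hd).
  now rewrite (is_C_derive_unique _ _ _ Hd).
Qed.

Lemma is_series_C_unique (a : nat -> C) (l1 l2 : C) :
  is_series (V := C_NormedModule) a l1 -> is_series (V := C_NormedModule) a l2 -> l1 = l2.
Proof.
  intros H1 H2.
  exact (filterlim_locally_unique (K := C_AbsRing) (V := C_NormedModule) _ _ _ H1 H2).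
Qed.

Lemma power_series_center (a : nat -> C) (z0 : C) (r : R) (h : C -> C) :
  0 < r -> power_series_on a z0 r h -> h z0 = a 0%nat.
Proof.
  intros Hr H.
  assert (E : (z0 - z0)%C = RtoC 0) by ring.
  assert (H0 := H z0 ltac:(rewrite E, Cmod_0; exact Hr)). rewrite E in H0.
  apply (is_series_C_unique _ _ _ H0).
  apply is_series_decr_1.
  assert (HC : is_series (V := C_NormedModule) (fun _ : nat => RtoC 0) (RtoC 0)).
  { apply (filterlim_ext (fun _ => RtoC 0)); [|apply filterlim_const].
    induction x as [|N IH]; [now rewrite sum_O|].
    rewrite sum_Sn, <- IH. ring_C. }
  match goal with |- is_series _ ?x => replace x with (RtoC 0) end.
  2:{ ring_C. }
  eapply is_series_ext; [|exact HC]. intro k. rewrite Cpow_S. ring_C.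
Qed.

(** The induction peels off the innermost derivative: [C_derive h] is again a power series on the
    whole disk, with shifted coefficients, so the hypothesis applies to it. *)
Lemma C_derive_n_power_series (z0 : C) (r : R) (k : nat) (a : nat -> C) (h : C -> C) :
  0 < r -> power_series_on a z0 r h ->
  C_derive_n k h z0 = (RtoC (INR (fact k)) * a k)%C.
Proof.
  intro Hr. revert a h. induction k as [|k IH]; intros a h H.
  - rewrite (power_series_center a z0 r h Hr H) at 1. simpl. ring.
  - unfold C_derive_n. rewrite Nat.iter_succ_r. fold (C_derive_n k (C_derive h)).
    rewrite (IH _ _ (power_series_C_derive a z0 r h H)).
    change (fact (S k)) with (S k * fact k)%nat. rewrite mult_INR, RtoC_mult. ring.
Qed.

(** * Taylor expansion with remainder *)

Lemma sum_n_sparse (f : nat -> C) (n : nat) : (2 <= n)%nat ->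
  (forall k, (2 <= k < n)%nat -> f k = 0%C) ->
  sum_n (G := C_NormedModule) f n = (f 0%nat + f 1%nat + f n)%C.
Proof.
  intros Hn Hf. destruct n as [|[|n]]; try lia.
  assert (G : forall m, (m <= n)%nat -> sum_n (G := C_NormedModule) f (S m) = (f 0%nat + f 1%nat)%C).
  { induction m as [|m IH]; intro Hm.
    - now rewrite sum_Sn, sum_O.
    - rewrite sum_Sn, IH by lia. rewrite (Hf (S (S m))) by lia. ring_C. }
  now rewrite sum_Sn, G.
Qed.

(** With [p = r / 2] the numbers [|a k| p^k] are bounded by [M]. For [|w| <= p / 2] the tail after
    index [n] is then dominated by a geometric series of ratio [1 / 2], whose sum gives the factor 2
    in [K]. *)
Lemma power_series_remainder (a : nat -> C) (z0 : C) (r : R) (h : C -> C) (n : nat) :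
  0 < r -> power_series_on a z0 r h -> (2 <= n)%nat ->
  (forall k, (2 <= k < n)%nat -> a k = 0%C) ->
  exists K rho, 0 <= K /\ 0 < rho < r /\
    forall w, Cmod w <= rho ->
      Cmod (h (z0 + w) - (a 0%nat + w * a 1%nat + w ^ n * a n))%C <= K * Cmod w ^ S n.
Proof.
  intros Hr H Hn Ha.
  destruct (power_series_coeff_bound a z0 r h (r / 2) H) as [M HM]; [lra|].
  set (p := r / 2) in *. assert (Hp : 0 < p) by (unfold p; lra).
  assert (HM0 : 0 <= M).
  { eapply Rle_trans; [|exact (HM 0%nat)]. simpl. generalize (Cmod_ge_0 (a 0%nat)). lra. }
  exists (2 * (M / p ^ S n)), (p / 2). split; [|split; [unfold p; lra|]].
  { apply Rmult_le_pos; [lra|]. apply Rdiv_le_0_compat; [exact HM0|apply pow_lt, Hp]. }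
  intros w Hw.
  assert (E : (z0 + w - z0)%C = w) by ring.
  assert (Hz := H (z0 + w)%C ltac:(rewrite E; unfold p in *; lra)). rewrite E in Hz.
  assert (Ht : is_series (V := C_NormedModule) (fun k => (w ^ (S n + k) * a (S n + k)%nat)%C)
    (h (z0 + w) - (a 0%nat + w * a 1%nat + w ^ n * a n))%C).
  { apply (is_series_incr_n (fun k => (w ^ k * a k)%C)); [lia|]. simpl Init.Nat.pred.
    match goal with |- is_series _ ?x => replace x with (h (z0 + w)%C) end; [exact Hz|].
    rewrite (sum_n_sparse (fun k => (w ^ k * a k)%C) n Hn).
    2:{ intros k Hk. rewrite Ha by exact Hk. ring. }
    ring_C. }
  replace (2 * (M / p ^ S n) * Cmod w ^ S n) with (M / p ^ S n * Cmod w ^ S n * / (1 - 1 / 2)) by (field; apply pow_nonzero; lra).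
  eapply Cmod_series_le; [exact Ht| |].
  2:{ apply (is_series_scal_l (V := R_NormedModule)), is_series_geom. rewrite Rabs_pos_eq; lra. }
  intro k. change (Cmod (w ^ (S n + k) * a (S n + k)%nat)%C <= M / p ^ S n * Cmod w ^ S n * (1 / 2) ^ k).
  rewrite Cmod_mult, Cmod_pow, pow_add.
  assert (Hk := HM (S n + k)%nat). rewrite pow_add in Hk.
  assert (Hw0 := Cmod_ge_0 w).
  assert (Hq : Cmod w ^ k <= p ^ k * (1 / 2) ^ k).
  { rewrite <- Rpow_mult_distr. apply pow_incr. lra. }
  set (A := Cmod (a (S n + k)%nat)) in *. set (P := p ^ S n) in *. set (Q := p ^ k) in *.
  set (W := Cmod w ^ S n).
  assert (HP : 0 < P) by apply pow_lt, Hp. assert (HQ : 0 < Q) by apply pow_lt, Hp.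
  assert (HW : 0 <= W) by (apply pow_le, Hw0).
  assert (HA : 0 <= A) by apply Cmod_ge_0.
  apply Rle_trans with (W * (Q * (1 / 2) ^ k) * A).
  - apply Rmult_le_compat_r; [exact HA|]. now apply Rmult_le_compat_l.
  - apply Rmult_le_reg_l with P; [exact HP|].
    replace (P * (M / P * W * (1 / 2) ^ k)) with (M * (W * (1 / 2) ^ k)) by (field; lra).
    replace (P * (W * (Q * (1 / 2) ^ k) * A)) with (A * (P * Q) * (W * (1 / 2) ^ k)) by ring.
    apply Rmult_le_compat_r; [|exact Hk]. apply Rmult_le_pos; [exact HW|apply pow_le; lra].
Qed.

(** * Continuous branches of the argument *)

Lemma cis_plus (a b : R) : cis (a + b) = (cis a * cis b)%C.
Proof. unfold cis, Cmult; simpl. rewrite cos_plus, sin_plus. f_equal; ring. Qed.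

Lemma Cmod_cis (t : R) : Cmod (cis t) = 1.
Proof.
  unfold Cmod, cis; simpl. transitivity (sqrt 1); [f_equal|apply sqrt_1].
  generalize (sin2_cos2 t). unfold Rsqr. lra.
Qed.

Lemma cis_neq_0 (t : R) : cis t <> 0%C.
Proof. intro E. generalize (Cmod_cis t). rewrite E, Cmod_0. lra. Qed.

Lemma cis_2PI (t : R) : cis (t + 2 * PI) = cis t.
Proof. unfold cis. now rewrite cos_plus, sin_plus, cos_2PI, sin_2PI, !Rmult_1_r, !Rmult_0_r, Rminus_0_r, Rplus_0_r. Qed.

(** Brings an angle into a compact interval, where uniform continuity is available. The arccosine
    serves when [sin t] is nonnegative, its reflection otherwise. *)
Lemma cis_range (t : R) : exists s, 0 <= s <= 2 * PI /\ cis t = cis s.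
Proof.
  assert (Hb := COS_bound t). assert (Ha := acos_bound (cos t)).
  assert (Hc : cos (acos (cos t)) = cos t) by now apply cos_acos.
  assert (Hs : sin (acos (cos t)) = Rabs (sin t)).
  { rewrite sin_acos by exact Hb. rewrite <- sqrt_Rsqr_abs. f_equal.
    generalize (sin2_cos2 t). lra. }
  destruct (Rle_dec 0 (sin t)) as [H|H].
  - exists (acos (cos t)). split; [lra|]. unfold cis.
    now rewrite Hc, Hs, Rabs_pos_eq.
  - exists (- acos (cos t) + 2 * PI). split; [lra|]. rewrite cis_2PI. unfold cis.
    rewrite cos_neg, sin_neg, Hc, Hs, Rabs_left by lra. now rewrite Ropp_involutive.
Qed.

(** The branch lives on all of [R], so that plain pointwise continuity can be used. The increment
    [d] is not divided by [2 * PI]; [has_branch_winding] does that. *)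
Definition has_branch (F : R -> C) (a b d : R) : Prop :=
  exists phi : R -> R,
    (forall t, continuous phi t) /\
    (forall t, F t = (RtoC (Cmod (F t)) * cis (phi t))%C) /\
    phi b - phi a = d.

Lemma has_branch_cis (phi : R -> R) (a b : R) :
  (forall t, continuous phi t) ->
  has_branch (fun t => cis (phi t)) a b (phi b - phi a).
Proof.
  intro H. exists phi. repeat split; auto.
  intro t. rewrite Cmod_cis. ring.
Qed.

(* The principal argument off the closed negative real axis, by the half-angle formula. *)
Definition slit_arg (z : C) : R := 2 * atan (snd z / (fst z + Cmod z)).

Lemma Cmod_sqr (z : C) : Cmod z * Cmod z = fst z * fst z + snd z * snd z.
Proof.
  unfold Cmod. rewrite sqrt_sqrt; [ring|].
  apply Rplus_le_le_0_compat; apply pow2_ge_0.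
Qed.

(** The hypothesis excludes exactly the closed negative real axis. With [m = |z|] and
    [w = v / (u + m)], the tangent of the half angle, [1 + w^2 = 2 m / (u + m)]; the double-angle
    formulas then give cosine [u / m] and sine [v / m]. *)
Lemma slit_arg_spec (z : C) : 0 < fst z + Cmod z ->
  z = (RtoC (Cmod z) * cis (slit_arg z))%C.
Proof.
  intro H. assert (Hm := Cmod_sqr z). assert (Hm0 := Cmod_ge_0 z).
  unfold slit_arg. destruct z as [u v]. simpl fst in *. simpl snd in *.
  set (m := Cmod (u, v)) in *. set (w := v / (u + m)).
  assert (Hmp : 0 < m).
  { destruct (Req_dec m 0) as [E|E]; [|lra]. rewrite E in Hm. nra. }
  assert (Hw : 0 < 1 + w ^ 2) by nra.
  assert (Hq : (cos (atan w)) ^ 2 = / (1 + w ^ 2)).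
  { rewrite cos_atan. unfold Rdiv. rewrite Rpow_mult_distr, pow_inv.
    rewrite pow2_sqrt; unfold Rsqr; [|nra]. field. nra. }
  assert (Hs : sin (atan w) = w * cos (atan w)).
  { rewrite sin_atan, cos_atan. unfold Rdiv. ring. }
  assert (Ew : 1 + w ^ 2 = 2 * m / (u + m)).
  { unfold w. apply Rmult_eq_reg_r with ((u + m) ^ 2); [|apply pow_nonzero; lra].
    field_simplify; [|lra|lra]. nra. }
  unfold cis, Cmult; simpl. f_equal.
  - rewrite cos_2a, Hs.
    replace (cos (atan w) * cos (atan w) - w * cos (atan w) * (w * cos (atan w)))
      with ((1 - w ^ 2) * cos (atan w) ^ 2) by ring.
    rewrite Hq, Ew. replace (1 - w ^ 2) with (2 - (1 + w ^ 2)) by ring. rewrite Ew.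
    field. lra.
  - rewrite sin_2a, Hs.
    replace (2 * (w * cos (atan w)) * cos (atan w)) with (2 * w * cos (atan w) ^ 2) by ring.
    rewrite Hq, Ew. unfold w. field. lra.
Qed.

(** * Continuity of complex-valued maps and of the principal argument *)

Lemma continuous_Cmod (z : C) : continuous Cmod z.
Proof.
  apply (filterlim_ext (fun x => @norm _ C_NormedModule x)); [reflexivity|].
  exact (filterlim_norm (K := C_AbsRing) (V := C_NormedModule) z).
Qed.

Lemma continuous_C_pair (U : UniformSpace) (f : U -> C) (x : U) :
  continuous (fun y => fst (f y)) x -> continuous (fun y => snd (f y)) x ->
  continuous (U := C_UniformSpace) f x.
Proof. apply filterlim_C_pair. apply locally_filter. Qed.

Lemma continuous_Re (U : UniformSpace) (f : U -> C) (x : U) :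
  continuous (U := C_UniformSpace) f x -> continuous (fun y => fst (f y)) x.
Proof. intro H. apply (continuous_comp f fst); [exact H|apply continuous_fst]. Qed.

Lemma continuous_Im (U : UniformSpace) (f : U -> C) (x : U) :
  continuous (U := C_UniformSpace) f x -> continuous (fun y => snd (f y)) x.
Proof. intro H. apply (continuous_comp f snd); [exact H|apply continuous_snd]. Qed.

Lemma continuous_Cmult (U : UniformSpace) (f g : U -> C) (x : U) :
  continuous (U := C_UniformSpace) f x -> continuous (U := C_UniformSpace) g x ->
  continuous (U := C_UniformSpace) (fun y => (f y * g y)%C) x.
Proof.
  intros Hf Hg. apply continuous_C_pair; simpl.
  - apply (continuous_minus (V := R_NormedModule)); apply (continuous_mult (K := R_AbsRing));
      first [now apply continuous_Re|now apply continuous_Im].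
  - apply (continuous_plus (V := R_NormedModule)); apply (continuous_mult (K := R_AbsRing));
      first [now apply continuous_Re|now apply continuous_Im].
Qed.

Lemma continuous_Cplus (U : UniformSpace) (f g : U -> C) (x : U) :
  continuous (U := C_UniformSpace) f x -> continuous (U := C_UniformSpace) g x ->
  continuous (U := C_UniformSpace) (fun y => (f y + g y)%C) x.
Proof.
  intros Hf Hg. apply continuous_C_pair; simpl;
    apply (continuous_plus (V := R_NormedModule));
      first [now apply continuous_Re|now apply continuous_Im].
Qed.

Lemma continuous_Cconj (U : UniformSpace) (f : U -> C) (x : U) :
  continuous (U := C_UniformSpace) f x ->
  continuous (U := C_UniformSpace) (fun y => Cconj (f y)) x.
Proof.
  intro Hf. apply continuous_C_pair; simpl.
  - now apply continuous_Re.
  - apply (continuous_opp (V := R_NormedModule)). now apply continuous_Im.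
Qed.

Lemma continuous_slit_arg (z : C) : 0 < fst z + Cmod z -> continuous slit_arg z.
Proof.
  intro H. unfold slit_arg.
  apply (continuous_mult (K := R_AbsRing)); [apply continuous_const|].
  apply continuous_comp; [|apply continuity_pt_filterlim, derivable_continuous_pt, derivable_pt_atan].
  apply (continuous_mult (K := R_AbsRing)); [apply continuous_snd|].
  apply continuous_comp.
  - apply (continuous_plus (V := R_NormedModule)); [apply continuous_fst|apply continuous_Cmod].
  - apply continuous_Rinv. lra.
Qed.

(* The branch for [F] is the branch for [G] plus the principal argument of [F / G]. *)
Lemma has_branch_transfer (F G : R -> C) (a b d : R) :
  (forall t, continuous (U := C_UniformSpace) F t) ->
  (forall t, continuous (U := C_UniformSpace) G t) ->
  F a = F b -> G a = G b ->
  (forall t, G t <> 0%C) ->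
  (forall t l, 0 <= l -> F t <> (RtoC (- l) * G t)%C) ->
  has_branch G a b d -> has_branch F a b d.
Proof.
  intros HF HG EF EG G0 HFG (phi & Hphi & Hb & Hd).
  (* [Q] is [F / G] times the positive number [|G|^2], so it has the same argument and needs no
     division. *)
  set (Q := fun t => (F t * Cconj (G t))%C).
  assert (GG : forall t, (Cconj (G t) * G t = RtoC (Cmod (G t) * Cmod (G t)))%C).
  { intro t. rewrite Cmod_sqr. destruct (G t) as [x y].
    unfold Cconj, Cmult, RtoC; simpl. f_equal; ring. }
  assert (Gp : forall t, 0 < Cmod (G t)) by (intro t; apply Cmod_gt_0, G0).
  assert (QG : forall t, (Q t * G t = F t * RtoC (Cmod (G t) * Cmod (G t)))%C).
  { intro t. rewrite <- GG. unfold Q. ring. }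
  (* Otherwise [Q t] is real and nonpositive, and [F t] is a nonpositive multiple of [G t], against
     the hypothesis. *)
  assert (HQ : forall t, 0 < fst (Q t) + Cmod (Q t)).
  { intro t. destruct (Rlt_dec 0 (fst (Q t) + Cmod (Q t))) as [H|H]; [exact H|exfalso].
    assert (Hm := Cmod_sqr (Q t)). assert (Hm0 := Cmod_ge_0 (Q t)).
    assert (Hs : snd (Q t) = 0) by nra.
    assert (Hr : fst (Q t) <= 0) by lra.
    assert (Gt := Gp t).
    apply (HFG t (- fst (Q t) / (Cmod (G t) * Cmod (G t)))).
    - apply Rdiv_le_0_compat; [lra|nra].
    - assert (EQ : Q t = RtoC (fst (Q t))) by (rewrite (surjective_pairing (Q t)) at 1; now rewrite Hs).
      assert (Gz : RtoC (Cmod (G t) * Cmod (G t)) <> 0%C).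
      { intro E. apply RtoC_inj in E. nra. }
      replace (- (- fst (Q t) / (Cmod (G t) * Cmod (G t))))
        with (fst (Q t) / (Cmod (G t) * Cmod (G t))) by (field; lra).
      rewrite RtoC_div, <- EQ by nra.
      replace (Q t / RtoC (Cmod (G t) * Cmod (G t)) * G t)%C
        with ((Q t * G t) / RtoC (Cmod (G t) * Cmod (G t)))%C by (field; exact Gz).
      rewrite QG. field. exact Gz. }
  exists (fun t => phi t + slit_arg (Q t)). split; [|split].
  - intro t. apply (continuous_plus (V := R_NormedModule)); [apply Hphi|].
    apply (continuous_comp Q slit_arg); [|apply continuous_slit_arg, HQ].
    apply continuous_Cmult; [apply HF|apply continuous_Cconj, HG].
  - intro t. assert (Gz : RtoC (Cmod (G t) * Cmod (G t)) <> 0%C).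
    { intro E. apply RtoC_inj in E. generalize (Gp t). nra. }
    assert (E : (F t * RtoC (Cmod (G t) * Cmod (G t))
      = RtoC (Cmod (F t)) * cis (phi t + slit_arg (Q t)) * RtoC (Cmod (G t) * Cmod (G t)))%C).
    { rewrite <- QG. rewrite (slit_arg_spec (Q t) (HQ t)) at 1. rewrite (Hb t) at 1.
      unfold Q at 1. rewrite Cmod_mult, Cmod_conj, cis_plus, !RtoC_mult. ring. }
    apply (f_equal (fun x => (x / RtoC (Cmod (G t) * Cmod (G t)))%C)) in E.
    replace (F t) with (F t * RtoC (Cmod (G t) * Cmod (G t)) / RtoC (Cmod (G t) * Cmod (G t)))%C at 1
      by (field; exact Gz).
    rewrite E. field. exact Gz.
  (* Both curves are closed, so the correction [slit_arg (Q t)] has the same value at both ends and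
     the increment is unchanged. *)
  - replace (Q b) with (Q a); [lra|]. unfold Q. now rewrite EF, EG.
Qed.

(** * Invariance of the winding under change of radius *)

Lemma continuous_cis (U : UniformSpace) (g : U -> R) (x : U) :
  continuous g x -> continuous (U := C_UniformSpace) (fun y => cis (g y)) x.
Proof.
  intro H. apply continuous_C_pair; simpl.
  - apply (continuous_comp g cos); [exact H|apply continuous_cos].
  - apply (continuous_comp g sin); [exact H|apply continuous_sin].
Qed.

Lemma continuous_RtoC (U : UniformSpace) (g : U -> R) (x : U) :
  continuous g x -> continuous (U := C_UniformSpace) (fun y => RtoC (g y)) x.
Proof. intro H. apply continuous_C_pair; simpl; [exact H|apply continuous_const]. Qed.

Lemma Cmod_circle (z0 : C) (r t : R) : Cmod (circle z0 r t - z0)%C = Rabs r.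
Proof.
  unfold circle. replace (z0 + RtoC r * cis t - z0)%C with (RtoC r * cis t)%C by ring.
  now rewrite Cmod_mult, Cmod_cis, Cmod_R, Rmult_1_r.
Qed.

Lemma circle_2PI (z0 : C) (r : R) : circle z0 r 0 = circle z0 r (2 * PI).
Proof. unfold circle. now rewrite <- (cis_2PI 0), Rplus_0_l. Qed.

Lemma circle_punctured_disk (z0 : C) (R0 r t : R) :
  0 < r < R0 -> punctured_disk z0 R0 (circle z0 r t).
Proof. intro H. unfold punctured_disk. rewrite Cmod_circle, Rabs_pos_eq; lra. Qed.

Lemma locally_punctured_disk (z0 : C) (R0 : R) (z : C) :
  punctured_disk z0 R0 z -> locally (T := C_UniformSpace) z (punctured_disk z0 R0).
Proof.
  intro H.
  assert (Hc : continuous (fun w => Cmod (w - z0)%C) z).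
  { apply (continuous_comp (fun w : C => (w - z0)%C) Cmod); [|apply continuous_Cmod].
    apply continuous_Cplus; [apply continuous_id|apply continuous_const]. }
  apply (Hc (fun x => 0 < x < R0)).
  apply (open_and (fun x => 0 < x) (fun x => x < R0)); [apply open_gt|apply open_lt|exact H].
Qed.

Lemma index_radius_continuous (f : C -> C) (z0 : C) (R0 : R) (z : C) :
  index_radius f z0 R0 -> punctured_disk z0 R0 z ->
  continuous (T := C_UniformSpace) (U := C_UniformSpace) f z.
Proof.
  intros (_ & Hc & _) Hz. apply (continuous_continuous_on (punctured_disk z0 R0)).
  - now apply locally_punctured_disk.
  - exact Hc.
Qed.

Lemma continuous_circle (z0 : C) (p : R * R) :
  continuous (U := C_UniformSpace) (fun q : R * R => circle z0 (fst q) (snd q)) p.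
Proof.
  unfold circle. apply continuous_Cplus; [apply continuous_const|].
  apply continuous_Cmult.
  - apply continuous_RtoC, continuous_fst.
  - apply continuous_cis, continuous_snd.
Qed.

Lemma continuous_circle_angle (z0 : C) (r t : R) :
  continuous (U := C_UniformSpace) (circle z0 r) t.
Proof.
  unfold circle. apply continuous_Cplus; [apply continuous_const|].
  apply continuous_Cmult; [apply continuous_const|apply continuous_cis, continuous_id].
Qed.

Lemma has_branch_winding (f : C -> C) (z0 : C) (R0 r : R) (k : Z) :
  index_radius f z0 R0 -> 0 < r < R0 ->
  has_branch (fun t => f (circle z0 r t)) 0 (2 * PI) (2 * PI * IZR k) ->
  winding f (circle z0 r) 0 (2 * PI) (IZR k).
Proof.
  intros HR Hr (psi & Hpsi & Hb & Hd).
  assert (HP := PI_RGT_0).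
  assert (Htr : forall z, trace (circle z0 r) 0 (2 * PI) z -> punctured_disk z0 R0 z).
  { intros z (t & _ & ->). now apply circle_punctured_disk. }
  split; [lra|]. split; [|split; [|split]].
  - apply continuous_on_forall. intros t _. apply continuous_circle_angle.
  - apply (continuous_on_subset (punctured_disk z0 R0)); [exact Htr|apply HR].
  - intros z Hz. apply HR. now apply Htr.
  - exists psi. split; [|split].
    + apply continuous_on_forall. intros t _. apply Hpsi.
    + intros t _. apply Hb.
    + rewrite Hd. field. lra.
Qed.

(* The unit vectors [f / |f|] at nearby radii differ by less than 1 in modulus, hence
   are not opposite. *)
Lemma radial_step_not_opposite (f : C -> C) (z0 : C) (R0 a b : R) :
  index_radius f z0 R0 -> 0 < a -> b < R0 ->
  exists d : posreal, forall r r' t, a <= r <= b -> a <= r' <= b -> Rabs (r' - r) < d ->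
    forall l, 0 <= l -> f (circle z0 r' t) <> (RtoC (- l) * f (circle z0 r t))%C.
Proof.
  intros HR Ha Hb.
  set (g := fun q : R * R => f (circle z0 (fst q) (snd q))).
  set (u := fun q : R * R => (g q * RtoC (/ Cmod (g q)))%C).
  assert (Hnz : forall q : R * R, a <= fst q <= b -> g q <> 0%C).
  { intros q Hq. apply HR, circle_punctured_disk. lra. }
  assert (Hg : forall q : R * R, a <= fst q <= b -> continuous (U := C_UniformSpace) g q).
  { intros q Hq. apply (continuous_comp (fun q : R * R => circle z0 (fst q) (snd q)) f).
    - apply continuous_circle.
    - apply (index_radius_continuous f z0 R0); [exact HR|].
      apply circle_punctured_disk. lra. }
  assert (Hu : forall q : R * R, a <= fst q <= b -> continuous (U := C_UniformSpace) u q).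
  { intros q Hq. unfold u. apply continuous_Cmult; [now apply Hg|].
    apply continuous_RtoC.
    apply (continuous_comp (fun q : R * R => Cmod (g q)) Rinv).
    - apply (continuous_comp g Cmod); [now apply Hg|apply continuous_Cmod].
    - apply continuous_Rinv. intro E. now apply (Hnz q Hq), Cmod_eq_0. }
  destruct (uniform_continuity_2d (fun x y => fst (u (x, y))) a b 0 (2 * PI)) with
    (mkposreal (1 / 2) ltac:(lra)) as [d1 H1].
  { intros x y Hx _. apply continuity_2d_pt_filterlim.
    apply filterlim_ext with (fun q => fst (u q)); [now intros [? ?]|].
    apply (continuous_Re _ u (x, y)). now apply Hu. }
  destruct (uniform_continuity_2d (fun x y => snd (u (x, y))) a b 0 (2 * PI)) with
    (mkposreal (1 / 2) ltac:(lra)) as [d2 H2].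
  { intros x y Hx _. apply continuity_2d_pt_filterlim.
    apply filterlim_ext with (fun q => snd (u q)); [now intros [? ?]|].
    apply (continuous_Im _ u (x, y)). now apply Hu. }
  exists (mkposreal _ (Rmin_stable_in_posreal d1 d2)). simpl.
  intros r r' t Hr Hr' Hd l Hl E.
  destruct (cis_range t) as (s & Hs & Ets).
  assert (E' : g (r', s) = (RtoC (- l) * g (r, s))%C).
  { unfold g; simpl. unfold circle in *. now rewrite <- Ets. }
  assert (Hd0 : Rabs (s - s) = 0) by (rewrite Rminus_diag_eq by reflexivity; apply Rabs_R0).
  specialize (H1 r s r' s Hr Hs Hr' Hs). specialize (H2 r s r' s Hr Hs Hr' Hs).
  cbv beta in H1, H2.
  assert (K1 := H1 (Rlt_le_trans _ _ _ Hd (Rmin_l _ _)) ltac:(rewrite Hd0; apply cond_pos)).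
  assert (K2 := H2 (Rlt_le_trans _ _ _ Hd (Rmin_r _ _)) ltac:(rewrite Hd0; apply cond_pos)).
  assert (N1 : 0 < Cmod (g (r, s))) by (apply Cmod_gt_0, Hnz; exact Hr).
  assert (N2 : 0 < Cmod (g (r', s))) by (apply Cmod_gt_0, Hnz; exact Hr').
  (* The value [l = 0] would make [f] vanish on the circle; for [l > 0] the unit vectors are exactly
     opposite. *)
  assert (Hl0 : 0 < l).
  { destruct Hl as [Hl|Hl]; [exact Hl|]. exfalso. subst l.
    rewrite E', Ropp_0, Cmult_0_l, Cmod_0 in N2. lra. }
  assert (EU : u (r', s) = (- u (r, s))%C).
  { unfold u. rewrite E', Cmod_mult, Cmod_R, Rabs_Ropp, Rabs_pos_eq by lra.
    rewrite Rinv_mult, RtoC_mult, (RtoC_opp l), (RtoC_inv l) by lra. field.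
    intro X. apply RtoC_inj in X. lra. }
  assert (MU : Cmod (u (r, s)) = 1).
  { unfold u. rewrite Cmod_mult, Cmod_R, Rabs_pos_eq by (apply Rlt_le, Rinv_0_lt_compat, N1).
    field. lra. }
  (* Opposite unit vectors with both components within [1 / 2] have components below [1 / 4] in
     absolute value, which contradicts modulus 1. *)
  rewrite EU in K1, K2.
  assert (HM := Cmod_sqr (u (r, s))). rewrite MU in HM.
  clear - K1 K2 HM. destruct (u (r, s)) as [p q]. simpl in *.
  apply Rabs_def2 in K1. apply Rabs_def2 in K2. nra.
Qed.

(** The passage from [r0] to [r1] is cut into equal steps shorter than the uniform [e]; the branch
    is transferred across each step. *)
Lemma has_branch_radius (f : C -> C) (z0 : C) (R0 r0 r1 d : R) :
  index_radius f z0 R0 -> 0 < r0 < R0 -> 0 < r1 < R0 ->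
  has_branch (fun t => f (circle z0 r0 t)) 0 (2 * PI) d ->
  has_branch (fun t => f (circle z0 r1 t)) 0 (2 * PI) d.
Proof.
  intros HR H0 H1 Hb.
  destruct (radial_step_not_opposite f z0 R0 (Rmin r0 r1) (Rmax r0 r1) HR) as [e He].
  { now apply Rmin_glb_lt. } { now apply Rmax_lub_lt. }
  assert (Hmin := conj (Rmin_l r0 r1) (Rmin_r r0 r1)).
  assert (Hmax := conj (Rmax_l r0 r1) (Rmax_r r0 r1)).
  assert (Hmp : 0 < Rmin r0 r1) by now apply Rmin_glb_lt.
  assert (HmR : Rmax r0 r1 < R0) by now apply Rmax_lub_lt.
  assert (He0 := cond_pos e).
  (* Since [|r1 - r0| / e < N + 1], dividing into [S N] steps makes each one shorter than [e]. *)
  destruct (nfloor_ex (Rabs (r1 - r0) / e)) as [N [_ HN]].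
  { apply Rdiv_le_0_compat; [apply Rabs_pos|exact He0]. }
  set (p := fun k => r0 + INR k / INR (S N) * (r1 - r0)).
  assert (HS : 0 < INR (S N)) by (apply lt_0_INR; lia).
  assert (Hp : forall k, (k <= S N)%nat -> Rmin r0 r1 <= p k <= Rmax r0 r1).
  { intros k Hk. unfold p.
    assert (Hq : 0 <= INR k / INR (S N) <= 1).
    { split; [apply Rdiv_le_0_compat; [apply pos_INR|exact HS]|].
      apply Rmult_le_reg_r with (INR (S N)); [exact HS|].
      unfold Rdiv. rewrite Rmult_assoc, Rinv_l, Rmult_1_r, Rmult_1_l by lra. now apply le_INR. }
    unfold Rmin, Rmax in *. destruct (Rle_dec r0 r1); nra. }
  assert (Hc : forall r t, Rmin r0 r1 <= r <= Rmax r0 r1 ->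
    continuous (U := C_UniformSpace) (fun t => f (circle z0 r t)) t).
  { intros r t Hr. apply (continuous_comp (circle z0 r) f); [apply continuous_circle_angle|].
    apply (index_radius_continuous f z0 R0); [exact HR|]. apply circle_punctured_disk. lra. }
  assert (G : forall k, (k <= S N)%nat -> has_branch (fun t => f (circle z0 (p k) t)) 0 (2 * PI) d).
  { induction k as [|k IH]; intro Hk.
    - replace (p 0%nat) with r0; [exact Hb|]. unfold p. simpl INR. unfold Rdiv. ring.
    - apply (has_branch_transfer _ (fun t => f (circle z0 (p k) t))).
      + intro t. apply Hc, Hp, Hk.
      + intro t. apply Hc, Hp. lia.
      + now rewrite circle_2PI.
      + now rewrite circle_2PI.
      + intro t. apply HR, circle_punctured_disk. generalize (Hp k ltac:(lia)). lra.
      + intros t l Hl. apply He; [apply Hp; lia|apply Hp; exact Hk| |exact Hl].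
        replace (p (S k) - p k) with ((r1 - r0) / INR (S N)).
        2:{ unfold p. rewrite (S_INR k). field. lra. }
        unfold Rdiv. rewrite Rabs_mult, Rabs_inv, (Rabs_pos_eq (INR (S N))) by lra.
        apply Rmult_lt_reg_r with (INR (S N)); [exact HS|].
        rewrite Rmult_assoc, Rinv_l, Rmult_1_r by lra. rewrite S_INR.
        apply Rmult_lt_reg_r with (/ e); [now apply Rinv_0_lt_compat|].
        replace (e * (INR N + 1) * / e) with (INR N + 1) by (field; lra). exact HN.
      + apply IH. lia. }
  replace r1 with (p (S N)); [now apply G|]. unfold p. field. lra.
Qed.

(** * The local estimate *)

Lemma cis_pow (t : R) (n : nat) : (cis t ^ n)%C = cis (INR n * t).
Proof.
  induction n as [|n IH].
  - simpl. unfold cis. now rewrite Rmult_0_l, cos_0, sin_0.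
  - rewrite Cpow_S, IH, S_INR, <- cis_plus. f_equal. ring.
Qed.

(** Telescoping: [cis t] and [cos t] have modulus at most 1 and differ by [Ci * sin t], so each
    factor contributes at most [|sin t|]. *)
Lemma Cmod_cis_pow_sub (t : R) (n : nat) :
  Cmod (cis t ^ n - RtoC (cos t) ^ n)%C <= INR n * Rabs (sin t).
Proof.
  induction n as [|n IH].
  - simpl. replace (1 - 1)%C with (RtoC 0) by ring. rewrite Cmod_0. lra.
  - rewrite !Cpow_S, S_INR.
    replace (cis t * cis t ^ n - RtoC (cos t) * RtoC (cos t) ^ n)%C
      with (cis t * (cis t ^ n - RtoC (cos t) ^ n) + (cis t - RtoC (cos t)) * RtoC (cos t) ^ n)%C by ring.
    eapply Rle_trans; [apply Cmod_triangle|].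
    rewrite !Cmod_mult, Cmod_cis, Cmod_pow, Cmod_R.
    replace (cis t - RtoC (cos t))%C with (Ci * RtoC (sin t))%C.
    2:{ unfold cis, Ci, Cminus, Cplus, Copp, Cmult, RtoC; simpl. apply f_equal2; ring. }
    rewrite Cmod_mult, Cmod_R, Cmod_Ci.
    assert (Rabs (cos t) ^ n <= 1).
    { rewrite <- (pow1 n). apply pow_incr. split; [apply Rabs_pos|].
      apply Rabs_le, COS_bound. }
    generalize (Rabs_pos (sin t)). nra.
Qed.

(** The real part of [Cmod_cis_pow_sub] after rotation by [cis alpha], which preserves the
    modulus. *)
Lemma cos_add_mul_approx (alpha t : R) (n : nat) :
  Rabs (cos (alpha + INR n * t) - cos t ^ n * cos alpha) <= INR n * Rabs (sin t).
Proof.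
  eapply Rle_trans; [|apply Cmod_cis_pow_sub].
  replace (Cmod (cis t ^ n - RtoC (cos t) ^ n)%C)
    with (Cmod (cis alpha * (cis t ^ n - RtoC (cos t) ^ n))%C)
    by (rewrite Cmod_mult, Cmod_cis; ring).
  eapply Rle_trans; [|apply Rabs_fst_le_Cmod].
  right. f_equal.
  replace (cis alpha * (cis t ^ n - RtoC (cos t) ^ n))%C
    with (cis (alpha + INR n * t) - cis alpha * RtoC (cos t ^ n))%C
    by (rewrite cis_plus, <- cis_pow, RtoC_pow; ring).
  unfold cis, Cmult, Cminus, Cplus, Copp, RtoC; simpl. ring.
Qed.

(** Bernoulli's inequality; with [x = (sin t)^2] it keeps [(cos t)^(2n)] close to 1. *)
Lemma pow_one_sub_ge (x : R) (n : nat) : 0 <= x <= 1 -> 1 - INR n * x <= (1 - x) ^ n.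
Proof.
  intro Hx. induction n as [|n IH]; [simpl; lra|].
  rewrite S_INR. simpl pow.
  assert (H := pos_INR n). assert (0 <= INR n * x * x) by nra. nra.
Qed.

(* [delta] separates the regimes [|sin t| >= delta] and [|sin t| < delta]; its value
   makes [n |sin t|], the error in [cos (alpha + n t) ~ (cos t)^n cos alpha], at most
   a quarter of [|cos alpha|] in the second one. *)
Lemma dominant_part_sign (n : nat) (b K alpha : R) :
  (2 <= n)%nat -> 0 < b -> 0 <= K -> cos alpha <> 0 ->
  exists r1, 0 < r1 /\ forall r t (Z : C), 0 < r < r1 ->
    Cmod (Z - (RtoC (b * r ^ n) * cis (alpha + INR n * t) + Ci * RtoC (2 * r * sin t)))%C
      <= K * r ^ S n ->
    0 < sin t * snd Z \/ 0 < cos alpha * cos t ^ n * fst Z.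
Proof.
  intros Hn Hb HK Heta. set (eta := cos alpha) in *.
  assert (Hn2 : 2 <= INR n) by (apply (le_INR 2) in Hn; exact Hn).
  assert (He : 0 < Rabs eta) by now apply Rabs_pos_lt.
  assert (He1 : Rabs eta <= 1) by apply Rabs_le, COS_bound.
  set (delta := Rabs eta / (4 * INR n)).
  assert (Hdn : INR n * delta = Rabs eta / 4) by (unfold delta; field; lra).
  assert (Hd : 0 < delta) by (unfold delta; apply Rdiv_lt_0_compat; lra).
  (* The bound 1 gives [r^n <= r^2]. The second bound puts all terms of order [r^2] below
     [2 r delta^2]; the third puts the remainder [K r^(n+1)] below half of [b r^n |eta|]. *)
  exists (Rmin 1 (Rmin (2 * delta ^ 2 / (b + K)) (b * Rabs eta / (2 * (K + 1))))).
  split.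
  { assert (0 < delta ^ 2) by now apply pow_lt.
    assert (0 < b * Rabs eta) by now apply Rmult_lt_0_compat.
    repeat apply Rmin_pos; [lra| |]; apply Rdiv_lt_0_compat; lra. }
  intros r t Z [Hr Hr1] HZ.
  assert (R1 : r < 1) by (eapply Rlt_le_trans; [exact Hr1|apply Rmin_l]).
  assert (R2 : (b + K) * r < 2 * delta ^ 2).
  { assert (r < 2 * delta ^ 2 / (b + K)).
    { eapply Rlt_le_trans; [exact Hr1|]. eapply Rle_trans; [apply Rmin_r|apply Rmin_l]. }
    apply (Rmult_lt_compat_l (b + K)) in H; [|lra].
    replace ((b + K) * (2 * delta ^ 2 / (b + K))) with (2 * delta ^ 2) in H by (field; lra). exact H. }
  assert (R3 : K * r < b * Rabs eta / 2).
  { assert (r < b * Rabs eta / (2 * (K + 1))).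
    { eapply Rlt_le_trans; [exact Hr1|]. eapply Rle_trans; [apply Rmin_r|apply Rmin_r]. }
    apply (Rmult_lt_compat_l (K + 1)) in H; [|lra].
    replace ((K + 1) * (b * Rabs eta / (2 * (K + 1)))) with (b * Rabs eta / 2) in H by (field; lra). lra. }
  set (x := cos t) in *. set (s := sin t) in *. set (p := alpha + INR n * t) in *.
  assert (Hsx : s * s + x * x = 1) by exact (sin2_cos2 t).
  assert (Hrn : 0 < r ^ n) by now apply pow_lt.
  assert (HX := Rle_trans _ _ _ (Rabs_fst_le_Cmod _) HZ).
  assert (HY := Rle_trans _ _ _ (Rabs_snd_le_Cmod _) HZ).
  replace (fst _) with (fst Z - b * r ^ n * cos p) in HX
    by (destruct Z; unfold cis, Cmult, Cminus, Cplus, Copp, RtoC, Ci; simpl; ring).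
  replace (snd _) with (snd Z - b * r ^ n * sin p - 2 * r * s) in HY
    by (destruct Z; unfold cis, Cmult, Cminus, Cplus, Copp, RtoC, Ci; simpl; ring).
  set (X := fst Z) in *. set (Y := snd Z) in *.
  simpl pow in HX, HY.
  destruct (Rle_lt_dec delta (Rabs s)) as [Hs|Hs].
  (* Here [s * Y] is [2 r s^2] up to an error of at most [(b + K) r^2], and this is less than
     [2 r delta^2 <= 2 r s^2]. *)
  - left.
    assert (Hs1 : Rabs s <= 1) by apply Rabs_le, SIN_bound.
    assert (Hp1 : Rabs (sin p) <= 1) by apply Rabs_le, SIN_bound.
    assert (Hr2 : r ^ n <= r * r).
    { replace n with (2 + (n - 2))%nat by lia. rewrite pow_add.
      assert (r ^ (n - 2) <= 1) by (rewrite <- (pow1 (n - 2)); apply pow_incr; lra).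
      simpl (r ^ 2). nra. }
    assert (HD : Rabs (Y - 2 * r * s) <= (b + K) * (r * r)).
    { replace (Y - 2 * r * s) with ((Y - b * r ^ n * sin p - 2 * r * s) + b * r ^ n * sin p) by ring.
      eapply Rle_trans; [apply Rabs_triang|].
      rewrite (Rabs_mult (b * r ^ n)), (Rabs_pos_eq (b * r ^ n)) by nra.
      assert (b * r ^ n * Rabs (sin p) <= b * (r * r)).
      { rewrite Rmult_assoc. apply Rmult_le_compat_l; [lra|].
        apply Rle_trans with (r ^ n * 1); [apply Rmult_le_compat_l|]; lra. }
      assert (K * (r * r ^ n) <= K * (r * r)) by (apply Rmult_le_compat_l; nra).
      lra. }
    assert (HS : Rabs (s * (Y - 2 * r * s)) <= (b + K) * (r * r)).
    { rewrite Rabs_mult. generalize (Rabs_pos (Y - 2 * r * s)) (Rabs_pos s). nra. }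
    apply Rabs_le_between in HS.
    assert (Hss : delta ^ 2 <= s * s).
    { replace (s * s) with (Rabs s ^ 2) by (rewrite pow2_abs; ring). apply pow_incr. lra. }
    assert ((b + K) * r * r < 2 * delta ^ 2 * r) by (apply Rmult_lt_compat_r; assumption).
    assert (2 * r * (s * s) >= 2 * r * delta ^ 2) by nra.
    nra.
  (* [X] differs from [b r^n y eta], where [y = x^n], by at most [3 / 4] of [b r^n |eta|]: a quarter
     from the cosine approximation, a half from the remainder. Since [n s^2 <= n delta^2 <= 1 / 32],
     [y^2] is at least [31 / 32], so the main term wins. *)
  - right.
    assert (Hcos := cos_add_mul_approx alpha t n). fold p x s eta in Hcos.
    assert (Hxn : Rabs (x ^ n) <= 1).
    { rewrite <- RPow_abs, <- (pow1 n). apply pow_incr. split; [apply Rabs_pos|apply Rabs_le, COS_bound]. }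
    assert (Hs2 : s * s <= delta ^ 2).
    { replace (s * s) with (Rabs s ^ 2) by (rewrite pow2_abs; ring). apply pow_incr.
      generalize (Rabs_pos s). lra. }
    assert (Hd4 : delta <= 1 / 8).
    { unfold delta. apply Rmult_le_reg_r with (4 * INR n); [lra|]. unfold Rdiv at 1.
      rewrite Rmult_assoc, Rinv_l; lra. }
    assert (Hxx : 1 - 1 / 32 <= x ^ n * x ^ n).
    { rewrite <- Rpow_mult_distr. replace (x * x) with (1 - s * s) by lra.
      eapply Rle_trans; [|apply pow_one_sub_ge; nra].
      assert (INR n * (s * s) <= INR n * delta ^ 2) by (apply Rmult_le_compat_l; lra).
      assert (INR n * delta ^ 2 = Rabs eta / 4 * delta) by (rewrite <- Hdn; ring).
      nra. }
    set (y := x ^ n) in *.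
    assert (Hns : INR n * Rabs s <= Rabs eta / 4).
    { rewrite <- Hdn. apply Rmult_le_compat_l; lra. }
    assert (HA : Rabs (X - b * r ^ n * (y * eta)) <= r ^ n * (b * Rabs eta * 3 / 4)).
    { replace (X - b * r ^ n * (y * eta))
        with ((X - b * r ^ n * cos p) + b * r ^ n * (cos p - y * eta)) by ring.
      eapply Rle_trans; [apply Rabs_triang|].
      rewrite (Rabs_mult (b * r ^ n)), (Rabs_pos_eq (b * r ^ n)) by nra.
      assert (b * r ^ n * Rabs (cos p - y * eta) <= b * r ^ n * (Rabs eta / 4))
        by (apply Rmult_le_compat_l; nra).
      assert (r ^ n * (K * r) <= r ^ n * (b * Rabs eta / 2)) by (apply Rmult_le_compat_l; lra).
      nra. }
    assert (HB : Rabs (eta * y * (X - b * r ^ n * (y * eta))) <= Rabs eta * (r ^ n * (b * Rabs eta * 3 / 4))).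
    { rewrite !Rabs_mult, Rmult_assoc. apply Rmult_le_compat_l; [apply Rabs_pos|].
      generalize (Rabs_pos (X - b * r ^ n * (y * eta))) (Rabs_pos y). nra. }
    apply Rabs_le_between in HB.
    assert (HE : Rabs eta * Rabs eta = eta * eta) by (rewrite <- Rabs_mult; apply Rabs_pos_eq; nra).
    assert (HP : 0 < b * r ^ n * (eta * eta)).
    { rewrite <- HE. repeat apply Rmult_lt_0_compat; assumption. }
    assert (b * r ^ n * (eta * eta) * (1 - 1 / 32) <= b * r ^ n * (eta * eta) * (y * y))
      by (apply Rmult_le_compat_l; lra).
    replace (Rabs eta * (r ^ n * (b * Rabs eta * 3 / 4))) with (b * r ^ n * (eta * eta) * (3 / 4)) in HB
      by (rewrite <- HE; field).
    nra.
Qed.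

(** * Reduction of the theorem to the local estimate *)

Lemma power_series_continuous (a : nat -> C) (z0 : C) (r : R) (h : C -> C) (z : C) :
  power_series_on a z0 r h -> Cmod (z - z0)%C < r ->
  continuous (T := C_UniformSpace) (U := C_UniformSpace) h z.
Proof.
  intros H Hz. destruct (power_series_derive a z0 r h z H Hz) as (l & _ & Hd).
  assert (Hc := ex_derive_continuous (K := C_AbsRing) (V := C_NormedModule) h z (ex_intro _ l Hd)).
  intros P HP. apply locally_C. exact (Hc P HP).
Qed.

Lemma Cconj_cis (t : R) : Cconj (cis t) = cis (- t).
Proof. unfold cis, Cconj; simpl. now rewrite cos_neg, sin_neg. Qed.

Lemma cis_PI_minus (t : R) : cis (PI - t) = (- cos t, sin t).
Proof. unfold cis. rewrite cos_minus, sin_minus, cos_PI, sin_PI. apply f_equal2; ring. Qed.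

(** Rotation by [-theta / 2] makes the linear part a difference of conjugates, hence purely
    imaginary. In [eta], one half of [theta] comes from this rotation and [n] halves from passing to
    the angle [t + theta / 2]; here [t] is the unshifted angle on the circle. *)
Lemma harmonic_principal_part (theta phi b r t : R) (n : nat) :
  (cis (- (theta / 2)) *
    (RtoC r * cis t * cis theta - Cconj (RtoC r * cis t) + (RtoC r * cis t) ^ n * (RtoC b * cis phi))
  = RtoC (b * r ^ n) * cis (phi - (INR n + 1) / 2 * theta + INR n * (t + theta / 2))
    + Ci * RtoC (2 * r * sin (t + theta / 2)))%C.
Proof.
  rewrite Cmult_conj, Cconj_cis.
  replace (Cconj (RtoC r)) with (RtoC r)
    by (unfold Cconj, RtoC; simpl; now rewrite Ropp_0).
  replace (Ci * RtoC (2 * r * sin (t + theta / 2)))%C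
    with (RtoC r * (cis (t + theta / 2) - cis (- (t + theta / 2))))%C.
  2:{ unfold cis, Ci, Cminus, Cplus, Copp, Cmult, RtoC; simpl.
      rewrite cos_neg, sin_neg. apply f_equal2; ring. }
  rewrite Cpow_mult_l, cis_pow, <- RtoC_pow, RtoC_mult.
  replace (cis (phi - (INR n + 1) / 2 * theta + INR n * (t + theta / 2)))
    with (cis (- (theta / 2)) * cis (INR n * t) * cis phi)%C
    by (rewrite <- !cis_plus; f_equal; field).
  replace (cis (t + theta / 2)) with (cis (- (theta / 2)) * cis t * cis theta)%C
    by (rewrite <- !cis_plus; f_equal; field).
  replace (cis (- (t + theta / 2))) with (cis (- (theta / 2)) * cis (- t))%C
    by (rewrite <- !cis_plus; f_equal; field).
  ring.
Qed.

Lemma pow_odd_mul_nonneg (x : R) (n : nat) : Nat.Odd n -> 0 <= x ^ n * x.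
Proof.
  intros [m ->]. replace (x ^ (2 * m + 1) * x) with ((x ^ 2) ^ S m); [apply pow_le, pow2_ge_0|].
  rewrite <- pow_mult. replace (2 * S m)%nat with (S (2 * m + 1)) by lia. simpl. ring.
Qed.

Theorem theorem4p6
  (D : C -> Prop) (hD : open D) (h : C -> C) (hh : analytic_on D h)
  (z0 : C)
  (hiso : isolated_zero D (harmonic_of h) z0)
  (hsing : singular_zero h z0)
  (theta : R) (htheta : C_derive h z0 = cis theta)
  (n : nat) (hn : (2 <= n)%nat)
  (c phi : R) (hc : 0 < c)
  (hderiv : C_derive_n n h z0 = (RtoC c * cis phi)%C)
  (hmin : forall k : nat, (2 <= k < n)%nat -> C_derive_n k h z0 = 0%C) :
  let eta := cos (phi - (INR n + 1) / 2 * theta) in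
  (eta <> 0 -> Nat.Even n -> poincare_index (harmonic_of h) z0 0) /\
  (eta > 0 -> Nat.Odd n -> poincare_index (harmonic_of h) z0 1) /\
  (eta < 0 -> Nat.Odd n -> poincare_index (harmonic_of h) z0 (-1)).
Proof.
  intro eta.
  destruct hiso as (Dz0 & Hzero & R0 & HR0 & Hnz).
  destruct (analytic_at_power_series h z0 (hh z0 Dz0)) as (a & r & Hr & Hps).
  assert (Hfact : forall k, RtoC (INR (fact k)) <> 0%C).
  { intros k E. apply RtoC_inj in E. now apply (INR_fact_neq_0 k). }
  set (b := c / INR (fact n)).
  assert (Hb : 0 < b) by (apply Rdiv_lt_0_compat; [exact hc|apply INR_fact_lt_0]).
  assert (Ha0 : a 0%nat = Cconj z0).
  { rewrite <- (power_series_center a z0 r h Hr Hps).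
    unfold harmonic_of in Hzero.
    replace (h z0) with (h z0 - Cconj z0 + Cconj z0)%C by ring. rewrite Hzero. ring. }
  assert (Hcoef : forall k, a k = (C_derive_n k h z0 / RtoC (INR (fact k)))%C).
  { intro k. rewrite (C_derive_n_power_series z0 r k a h Hr Hps). field. apply Hfact. }
  assert (Ha1 : a 1%nat = cis theta).
  { rewrite Hcoef. change (C_derive_n 1 h z0) with (C_derive h z0). rewrite htheta.
    simpl. field. }
  assert (Han : a n = (RtoC b * cis phi)%C).
  { rewrite Hcoef, hderiv. unfold b. rewrite RtoC_div by apply INR_fact_neq_0. field. apply Hfact. }
  destruct (power_series_remainder a z0 r h n Hr Hps hn) as (K & rho & HK & Hrho & Hrem).
  { intros k Hk. rewrite Hcoef, (hmin k Hk). field. apply Hfact. }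
  assert (Hcont : forall z, Cmod (z - z0)%C < r ->
    continuous (T := C_UniformSpace) (U := C_UniformSpace) (harmonic_of h) z).
  { intros z Hz. unfold harmonic_of.
    apply (continuous_ext (U := C_UniformSpace) (fun z => (h z + RtoC (-1) * Cconj z)%C)); [intro x; ring_C|].
    apply continuous_Cplus; [now apply (power_series_continuous a z0 r)|].
    apply continuous_Cmult; [apply continuous_const|apply continuous_Cconj, continuous_id]. }
  (* The radius must stay within the disk of convergence, the isolation radius and a ball contained
     in [D], because isolation is only assumed for points of [D]. *)
  assert (Hidx : exists R1, R1 <= r /\ index_radius (harmonic_of h) z0 R1).
  { destruct (hD z0 Dz0) as [e He].
    assert (Hm : 0 < Rmin r (Rmin R0 e)) by (repeat apply Rmin_pos; try assumption; apply cond_pos).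
    exists (Rmin r (Rmin R0 e)). split; [apply Rmin_l|]. split; [exact Hm|split].
    - apply continuous_on_forall. intros z [_ Hz]. apply Hcont.
      eapply Rlt_le_trans; [exact Hz|apply Rmin_l].
    - intros z [Hz1 Hz2]. apply Hnz.
      + apply He. apply C_NormedModule_mixin_compat1.
        eapply Rlt_le_trans; [exact Hz2|]. eapply Rle_trans; apply Rmin_r.
      + split; [exact Hz1|]. eapply Rlt_le_trans; [exact Hz2|].
        eapply Rle_trans; [apply Rmin_r|apply Rmin_l]. }
  destruct Hidx as (R1 & HR1 & Hidx).
  (* The three cases differ only in the argument [psi] of the model curve. What they must supply is
     a sign check: a [Z] with the signs found by [dominant_part_sign] is never opposite to
     [cis (psi t)]. *)
  assert (Main : forall (psi : R -> R) (k : Z), eta <> 0 ->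
    (forall t, continuous psi t) -> psi (2 * PI) - psi 0 = 2 * PI * IZR k ->
    cis (psi 0) = cis (psi (2 * PI)) ->
    (forall t l (Z : C), 0 <= l ->
      0 < sin (t + theta / 2) * snd Z \/ 0 < eta * cos (t + theta / 2) ^ n * fst Z ->
      Z <> (RtoC (- l) * cis (psi t))%C) ->
    poincare_index (harmonic_of h) z0 k).
  { intros psi k Heta Hpsi Hk Hper Hcmp. split; [now exists R1|].
    intros R2 s HR2 Hs. apply (has_branch_winding _ _ R2); [exact HR2|exact Hs|].
    destruct (dominant_part_sign n b K _ hn Hb HK Heta) as (r1 & Hr1 & Hsign).
    (* [R2] and [s] are arbitrary admissible radii. The comparison with the model is made at the
       small radius [q], and [has_branch_radius] carries it to [s]. *)
    set (q := Rmin (Rmin r1 rho) (Rmin R1 R2) / 2).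
    assert (Hq0 : 0 < Rmin (Rmin r1 rho) (Rmin R1 R2)).
    { repeat apply Rmin_pos; [exact Hr1|lra|apply Hidx|apply HR2]. }
    assert (Hq1 : q < Rmin (Rmin r1 rho) (Rmin R1 R2)) by (unfold q; lra).
    assert (Hq : 0 < q) by (unfold q; lra).
    apply Rmin_Rgt in Hq1. destruct Hq1 as [Hq1 Hq2].
    apply Rmin_Rgt in Hq1. apply Rmin_Rgt in Hq2.
    apply (has_branch_radius _ _ R2 q s); [exact HR2|lra|exact Hs|].
    (* The model is turned back by [theta / 2], since the estimate concerns the rotated value [Z] of
       [f]. *)
    apply (has_branch_transfer _ (fun t => cis (theta / 2 + psi t))).
    - intro t. apply (continuous_comp (circle z0 q) (harmonic_of h)); [apply continuous_circle_angle|].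
      apply Hcont. rewrite Cmod_circle, Rabs_pos_eq; lra.
    - intro t. apply continuous_cis.
      apply (continuous_plus (V := R_NormedModule)); [apply continuous_const|apply Hpsi].
    - now rewrite circle_2PI.
    - now rewrite !cis_plus, Hper.
    - intro t. apply cis_neq_0.
    - intros t l Hl E.
      set (w := (RtoC q * cis t)%C).
      assert (Hw : Cmod w = q) by (unfold w; rewrite Cmod_mult, Cmod_cis, Cmod_R, Rabs_pos_eq; lra).
      set (Z := (cis (- (theta / 2)) * harmonic_of h (circle z0 q t))%C).
      apply (Hcmp t l Z Hl).
      + apply (Hsign q (t + theta / 2) Z); [lra|].
        rewrite <- harmonic_principal_part. unfold Z.
        assert (HE := Hrem w ltac:(lra)). rewrite Hw, Ha0, Ha1, Han in HE.
        eapply Rle_trans; [|exact HE]. right.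
        rewrite <- (Rmult_1_l (Cmod (h (z0 + w)%C - _)%C)), <- (Cmod_cis (- (theta / 2))), <- Cmod_mult.
        f_equal. unfold harmonic_of, circle. fold w. rewrite Cplus_conj. ring.
      + unfold Z. rewrite E, cis_plus.
        replace (cis (- (theta / 2)) * (RtoC (- l) * (cis (theta / 2) * cis (psi t))))%C
          with (cis (- (theta / 2)) * cis (theta / 2) * (RtoC (- l) * cis (psi t)))%C by ring.
        rewrite <- cis_plus. replace (- (theta / 2) + theta / 2) with 0 by ring.
        unfold cis at 1. rewrite cos_0, sin_0. change (1, 0) with (RtoC 1). ring.
    - rewrite <- Hk. replace (psi (2 * PI) - psi 0)
        with ((theta / 2 + psi (2 * PI)) - (theta / 2 + psi 0)) by ring.
      apply (has_branch_cis (fun t => theta / 2 + psi t)). intro t.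
      apply (continuous_plus (V := R_NormedModule)); [apply continuous_const|apply Hpsi]. }
  assert (Hshift : forall t, continuous (fun t => t + theta / 2) t).
  { intro t. apply (continuous_plus (V := R_NormedModule)); [apply continuous_id|apply continuous_const]. }
  split; [|split].
  - intros Heta [m Hm].
    assert (Hpow : forall x, 0 <= x ^ n).
    { intro x. rewrite Hm, pow_mult. apply pow_le, pow2_ge_0. }
    (* The constant model is 1 or -1, with the sign of [eta]. As [(cos t)^n] is nonnegative for even
       [n], a value opposite to it violates both sign alternatives. *)
    assert (Hsgn : exists p sg, cis p = RtoC sg /\ 0 < eta * sg).
    { destruct (Rlt_dec 0 eta) as [H|H].
      - exists 0, 1. split; [unfold cis; now rewrite cos_0, sin_0|lra].
      - exists PI, (-1). split; [unfold cis; now rewrite cos_PI, sin_PI|].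
        destruct (Rtotal_order eta 0) as [|[|]]; lra. }
    destruct Hsgn as (p & sg & Hp & Hsg).
    apply (Main (fun _ => p)); [exact Heta|intro; apply continuous_const|ring|reflexivity|].
    intros t l Z Hl HZ E. rewrite Hp in E. subst Z. simpl in HZ.
    generalize (Hpow (cos (t + theta / 2))).
    set (y := cos (t + theta / 2) ^ n) in *. intro Hy.
    assert (0 <= l * y * (eta * sg)) by (apply Rmult_le_pos; [now apply Rmult_le_pos|lra]).
    destruct HZ as [HZ|HZ]; ring_simplify in HZ; lra.
  - intros Heta Hodd.
    assert (Hpow := fun x => pow_odd_mul_nonneg x n Hodd).
    (* For [Z = -l cis (t + theta / 2)] the two products are [-l s^2] and [-l eta x^(n+1)], both
       nonpositive because [n + 1] is even. *)
    apply (Main (fun t => t + theta / 2)); [lra|exact Hshift|ring| |].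
    { rewrite <- (cis_2PI (0 + theta / 2)). f_equal. ring. }
    intros t l Z Hl HZ E. subst Z. simpl in HZ.
    set (x := cos (t + theta / 2)) in *. set (s := sin (t + theta / 2)) in *.
    assert (0 <= l * (x ^ n * x) * eta) by (apply Rmult_le_pos; [apply Rmult_le_pos; auto|lra]).
    assert (0 <= l * (s * s)) by (apply Rmult_le_pos; nra).
    destruct HZ as [HZ|HZ]; ring_simplify in HZ; nra.
  - intros Heta Hodd.
    assert (Hpow := fun x => pow_odd_mul_nonneg x n Hodd).
    (* Reflection in the imaginary axis changes the sign of the real part, which compensates
       [eta < 0], and reverses the orientation, whence the index -1. *)
    apply (Main (fun t => PI - (t + theta / 2))); [lra| |ring| |].
    { intro t. apply (continuous_minus (V := R_NormedModule)); [apply continuous_const|apply Hshift]. }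
    { rewrite <- (cis_2PI (PI - (2 * PI + theta / 2))). f_equal. ring. }
    intros t l Z Hl HZ E. rewrite cis_PI_minus in E. subst Z. simpl in HZ.
    set (x := cos (t + theta / 2)) in *. set (s := sin (t + theta / 2)) in *.
    assert (0 <= l * (x ^ n * x) * (- eta)) by (apply Rmult_le_pos; [apply Rmult_le_pos; auto|lra]).
    assert (0 <= l * (s * s)) by (apply Rmult_le_pos; nra).
    destruct HZ as [HZ|HZ]; ring_simplify in HZ; nra.
Qed.
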